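(* Let $m$ be a positive integer, $l$ a non-negative integer, $q=2^m$, and $\delta\in\mathbb{F}_{q^3}$. Put $A=\mathrm{Tr}_m^{3m}(\delta^{2+q}+\delta^{2+q^2})$, $B=\mathrm{Tr}_m^{3m}(\delta^2+\delta^{1+q})$ and $D=\delta^{q^2+q+1}\mathrm{Tr}_m^{3m}(\delta)$. Assume that $$f(x)=\left(\mathrm{Tr}_m^{3m}(x)+\delta\right)^{q^2+q+2}+\mathrm{Tr}_m^{3m}(x)^{2^l}+x^{2^l}$$ permutes $\mathbb{F}_{q^3}$. Then: (1) If $A=0$ and $B=0$, the compositional inverse of $f$ over $\mathbb{F}_{q^3}$ is $$f^{-1}(x)=x^{q^3/2^l}+\left((\mathrm{Tr}_m^{3m}(x)+D)^{q/4}+\delta\right)^{(q^2+q+2)q^3/2^l}+(\mathrm{Tr}_m^{3m}(x)+D)^{q/4}.$$ (2) If $B=0$ and $A\neq0$ is not a cube of an element of $\mathbb{F}_q$, then, with $d=\gcd(m,2)$ and $N=N_{2^m/2^d}(A)=A^{(2^m-1)/(2^d-1)}$, and $L(x)=\frac{N}{1+N}\sum_{i=0}^{m/d-1}A^{-\frac{4^{i+1}-1}{3}}\left(\mathrm{Tr}_m^{3m}(x)+D\right)^{4^i}$, the compositional inverse of $f$ over $\mathbb{F}_{q^3}$ is $$f^{-1}(x)=\left(\delta+L(x)\right)^{(q^2+q+2)q^3/2^l}+x^{q^3/2^l}+L(x).$$ (3) If $AB\neq0$, let $(S_i)_{i\ge -1}$ be the sequence with $S_{-1}=0$, $S_0=1$,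 $S_i=B^{2^{i-1}}S_{i-1}+A^{2^{i-1}}S_{i-2}$ for $i\ge1$, and let $M(x)=\sum_{i=0}^{m-1}\left(S_{m-2-i}^{2^{i+1}}+A^{1-2^{i+1}}S_i\right)\left(\mathrm{Tr}_m^{3m}(x)+D\right)^{2^i}$. Then the compositional inverse of $f$ over $\mathbb{F}_{q^3}$ is $$f^{-1}(x)=\left(\delta+M(x)\right)^{(q^2+q+2)q^3/2^l}+x^{q^3/2^l}+M(x).$$
   Context: $\mathrm{Tr}_m^{3m}(x)=x+x^{q}+x^{q^2}$ is the trace map from $\mathbb{F}_{q^3}$ to $\mathbb{F}_q$. For $d\mid m$, $N_{2^m/2^d}$ denotes the norm map from $\mathbb{F}_{2^m}$ to $\mathbb{F}_{2^d}$, $N_{2^m/2^d}(a)=a^{(2^m-1)/(2^d-1)}$. Exponents written as fractions such as $q^3/2^l$ and $q/4$ denote the corresponding powers of $2$ (e.g. $q^3/2^l=2^{3m-l}$). The compositional inverse of a permutation polynomial $F$ of $\mathbb{F}_{q^3}$ is the unique polynomial map $F^{-1}$ with $F(F^{-1}(x))=F^{-1}(F(x))=x$ for all $x\in\mathbb{F}_{q^3}$. *)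

(* Defs.v *)
From HB Require Import structures.
From mathcomp Require Import all_boot all_order all_algebra all_field.
Set Implicit Arguments.
Unset Strict Implicit.
Unset Printing Implicit Defensive.
Import Order.TTheory GRing.Theory Num.Theory.
Local Open Scope ring_scope.

(* frob2 x k is x ^ (2 ^ k) for an integer k.  In characteristic 2 the map
   y |-> y ^ (2 ^ j) is a bijection of the finite field F, and the exponent
   2 ^ (- j) denotes its inverse (fingraph's finv); see frob2NK. *)
Definition frob2 (F : finFieldType) (x : F) (k : int) : F :=
  match k with
  | Posz j => x ^+ (2 ^ j)
  | Negz j => finv (fun y : F => y ^+ (2 ^ j.+1)) x
  end.

Lemma frob2NK (F : finFieldType) (x : F) (j : nat) :
  2%N \in [pchar F] -> frob2 x (- (j%:Z)) ^+ (2 ^ j) = x.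
Proof.
move=> ch2; case: j => [|j]; first by rewrite oppr0 /= !expr1.
have inj : injective (fun y : F => y ^+ (2 ^ j.+1)).
  elim: j.+1 => [|i IHi] y z; first by rewrite !expr1.
  rewrite expnSr !exprM => /(@fmorph_inj _ _ (pFrobenius_aut ch2)).
  exact: IHi.
by rewrite -NegzE /=; exact: (f_finv inj x).
Qed.

(* The trace from F_{q^3} to F_q, with values viewed in F_{q^3}. *)
Definition tr3 (F : finFieldType) (q : nat) (x : F) : F :=
  x + x ^+ q + x ^+ (q ^ 2).

Definition cA (F : finFieldType) (q : nat) (delta : F) : F :=
  tr3 q (delta ^+ (2 + q) + delta ^+ (2 + q ^ 2)).

Definition cB (F : finFieldType) (q : nat) (delta : F) : F :=
  tr3 q (delta ^+ 2 + delta ^+ (1 + q)).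

Definition cD (F : finFieldType) (q : nat) (delta : F) : F :=
  delta ^+ (q ^ 2 + q + 1) * tr3 q delta.

Definition fpoly (F : finFieldType) (q l : nat) (delta x : F) : F :=
  (tr3 q x + delta) ^+ (q ^ 2 + q + 2) + tr3 q x ^+ (2 ^ l) + x ^+ (2 ^ l).

Definition comp_inverse (F : finFieldType) (f g : F -> F) : Prop :=
  cancel f g /\ cancel g f.

(* The norm from F_{2^m} to F_{2^d}, d dividing m; the quotient is exact. *)
Definition norm2 (F : finFieldType) (m d : nat) (a : F) : F :=
  a ^+ ((2 ^ m - 1) %/ (2 ^ d - 1)).

(* y stands for Tr(x) + D; all the natural-number quotients are exact. *)
Definition Lmap (F : finFieldType) (m : nat) (A y : F) : F :=
  let d := gcdn m 2 in
  let N := norm2 m d A in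
  N / (1 + N) *
    \sum_(0 <= i < m %/ d) A ^- ((4 ^ i.+1 - 1) %/ 3) * y ^+ (4 ^ i).

(* Indices are shifted by one: Sseq A B n is S_{n-1}, so that
   Sseq A B 0 = S_{-1} = 0 and Sseq A B 1 = S_0 = 1. *)
Fixpoint Sseq (F : finFieldType) (A B : F) (n : nat) {struct n} : F :=
  match n with
  | 0 => 0
  | n'.+1 =>
    match n' with
    | 0 => 1
    | i.+1 => B ^+ (2 ^ i) * Sseq A B n' + A ^+ (2 ^ i) * Sseq A B i
    end
  end.

(* y stands for Tr(x) + D; Sseq A B (m - 1 - i) is S_{m-2-i}, where
   i <= m - 1, and Sseq A B i.+1 is S_i. *)
Definition Mmap (F : finFieldType) (m : nat) (A B y : F) : F :=
  \sum_(0 <= i < m)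
    (Sseq A B (m - 1 - i) ^+ (2 ^ i.+1)
      + A ^ (1 - (2 ^ i.+1)%:Z) * Sseq A B i.+1) * y ^+ (2 ^ i).

(* Main.v *)
(* Put T = Tr(x).  In characteristic 2 one has Tr(f(x)) + D = P(T) with
   P(T) = T^4 + B T^2 + A T, so surjectivity of f forces that of P on F_q, and
   x is recovered from f(x) and T alone; it remains to invert P on F_q.
   If A = B = 0 this is the extraction of a fourth root.
   If B = 0, the sum in L telescopes on P(T) to T / N + T.  For m odd every
   element of F_q is a cube; for m even, N = 1 would make the sum vanish on
   P(F_q) = F_q although it is a nonzero polynomial of degree below q.
   If AB <> 0, then M(P(T)) = Z T with Z = S_m + A S_{m-2}^2.  The two mirror
   recurrences of S give Z^2 = Z.  If Z were 0, then M would vanish on F_q, so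
   its coefficients would be 0, which gives S_{m-1} = 0 and A S_{m-2}^2 = 1; the
   quotient of T^q by P would then vanish on F_q too, although it has degree
   below q and leading coefficient 1. *)

Require Import Defs.
From HB Require Import structures.
From mathcomp Require Import all_boot all_order all_algebra all_field.
From mathcomp Require Import ring zify.
Import Order.TTheory GRing.Theory Num.Theory.
Local Open Scope ring_scope.

(** * Exponents that are powers of 2, in characteristic 2 *)

Lemma pchar2_2eq0 (F : nzRingType) : 2%N \in [pchar F] -> 2%:R = 0 :> F.
Proof. by case/andP=> _ /eqP. Qed.

Lemma exprDn_pchar2 (F : comNzRingType) (k : nat) (x y : F) :
  2%N \in [pchar F] ->
  (x + y) ^+ (2 ^ k) = x ^+ (2 ^ k) + y ^+ (2 ^ k).
Proof.
move=> ch2; apply: exprDn_pchar.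
by rewrite (eq_pnat _ (pcharf_eq ch2)) pnatX pnat_id.
Qed.

Lemma sqrrD_pchar2 (F : comNzRingType) (x y : F) :
  2%N \in [pchar F] -> (x + y) ^+ 2 = x ^+ 2 + y ^+ 2.
Proof. exact: (@exprDn_pchar2 F 1). Qed.

Lemma expr2n_inj (F : idomainType) (k : nat) :
  2%N \in [pchar F] -> injective (fun x : F => x ^+ (2 ^ k)).
Proof.
move=> ch2 x y /= exy; apply/eqP; rewrite -subr_eq0.
have /eqP : (x + y) ^+ (2 ^ k) = 0.
  by rewrite exprDn_pchar2 // exy addrr_pchar2.
by rewrite expf_eq0 => /andP[_]; rewrite -{1}(oppr_pchar2 ch2 y).
Qed.

Lemma sum_sqr_pchar2 (F : comNzRingType) (I : Type) (r : seq I) (G : I -> F) :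
  2%N \in [pchar F] -> (\sum_(i <- r) G i) ^+ 2 = \sum_(i <- r) G i ^+ 2.
Proof.
move=> ch2; elim: r => [|i r IHr]; first by rewrite !big_nil expr0n.
by rewrite !big_cons sqrrD_pchar2 // IHr.
Qed.

(** Makes q^3/2^l and q/4 behave as exponents even when the difference [n - l] is negative. *)
Lemma frob2BK (F : finFieldType) (z : F) (n l : nat) :
  2%N \in [pchar F] -> z ^+ (2 ^ n) = z ->
  frob2 z (n%:Z - l%:Z) ^+ (2 ^ l) = z.
Proof.
move=> ch2 zn; case: (leqP l n) => [le_ln | /ltnW le_nl].
  by rewrite subzn //= -exprM -expnD subnK.
have -> : n%:Z - l%:Z = - (l - n)%:Z by lia.
by rewrite -{2}(subnK le_nl) expnD exprM frob2NK.
Qed.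

(** * The subfield as a fixed field, and polynomials vanishing on it *)

Section SubfieldImage.

Variables (K L : finFieldType) (iota : {rmorphism K -> L}).

(** X^|K| - X is the product of the X - y over [K]; its image under [iota] vanishes at [x], so some
    factor does. *)
Lemma fixed_imageP (x : L) :
  x ^+ #|K| = x -> exists y : K, x = iota y.
Proof.
move=> xq.
have := congr1 (fun p => (map_poly iota p).[x]) (finField_genPoly K).
rewrite rmorphB rmorph_prod rmorphXn /= !map_polyX !hornerE xq subrr.
rewrite horner_prod => /esym/eqP/prodf_eq0[y _].
rewrite rmorphB /= map_polyX map_polyC /= !hornerE subr_eq0 => /eqP ->.
by exists y.
Qed.

(** The degree is at most p^(k-1) < |K|, yet the whole image of [K] consists of roots. *)
Lemma additive_poly_coef0 (p k : nat) (c : nat -> L) :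
  (1 < p)%N -> (p ^ k <= #|K|)%N ->
  (forall x : L, x ^+ #|K| = x -> \sum_(0 <= i < k) c i * x ^+ (p ^ i) = 0) ->
  forall i, (i < k)%N -> c i = 0.
Proof.
move=> p_gt1 le_pkK vanish i lt_ik.
pose P : {poly L} := \sum_(0 <= j < k) c j *: 'X^(p ^ j).
have size_P : (size P <= #|K|)%N.
  rewrite /P big_mkord; apply: (leq_trans (size_sum _ _ _)).
  apply/bigmax_leqP => j _; apply: leq_trans (size_scale_leq _ _) _.
  rewrite size_polyXn; apply: leq_trans le_pkK.
  by rewrite ltn_exp2l.
have P0 : P = 0.
  apply/eqP; case: eqP => // /eqP nzP.
  have /(max_poly_roots nzP) : all (root P) (map iota (enum K)).
    apply/allP => _ /mapP[y _ ->]; apply/rootP.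
    rewrite /P horner_sum -[RHS](vanish (iota y)); last first.
      by rewrite -rmorphXn expf_card.
    by apply: eq_bigr => j _; rewrite !hornerE.
  rewrite map_inj_uniq ?enum_uniq; last exact: fmorph_inj.
  by rewrite size_map -cardE ltnNge size_P => /(_ isT).
have := congr1 (fun R : {poly L} => R`_(p ^ i)) P0.
rewrite coef0 /P coef_sum big_mkord (bigD1 (Ordinal lt_ik)) //= big1.
  by rewrite coefZ coefXn eqxx mulr1 addr0.
move=> j nij; rewrite coefZ coefXn eqn_exp2l // [(i == j :> nat)]eq_sym.
by rewrite (negbTE (_ : (j != i :> nat))) ?mulr0.
Qed.

End SubfieldImage.

(** * The polynomial T^4 + A T *)

Lemma expn4 (m : nat) : (4 ^ m)%N = (2 ^ (2 * m))%N.
Proof. by rewrite expnM. Qed.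

(** Put e_i = (4^i - 1)/3. As e_{i+1} = 4^i + e_i, the term of index [i] is A^(-e_{i+1}) T^(4^(i+1))
    + A^(-e_i) T^(4^i), and neighbours cancel. *)
Lemma telescope_pow4 (F : fieldType) (A T : F) (k : nat) :
  2%N \in [pchar F] -> A != 0 ->
  \sum_(0 <= i < k) A ^- ((4 ^ i.+1 - 1) %/ 3) * (T ^+ 4 + A * T) ^+ (4 ^ i)
  = A ^- ((4 ^ k - 1) %/ 3) * T ^+ (4 ^ k) + T.
Proof.
move=> ch2 nzA; have two0 := pchar2_2eq0 _ ch2.
elim: k => [|k IHk].
  by rewrite big_nil subnn div0n expr0 invr1 mul1r expr1 addrr_pchar2.
have e4 : (((4 ^ k.+1 - 1) %/ 3) = 4 ^ k + (4 ^ k - 1) %/ 3)%N.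
  rewrite -divnMDl // expnS; congr (_ %/ 3)%N.
  have : (0 < 4 ^ k)%N by rewrite expn_gt0.
  lia.
rewrite big_nat_recr //= IHk.
have -> : (T ^+ 4 + A * T) ^+ (4 ^ k) = T ^+ (4 ^ k.+1) + A ^+ (4 ^ k) * T ^+ (4 ^ k).
  rewrite expn4 exprDn_pchar2 //.
  rewrite [(A * T) ^+ _]exprMn -exprM -(expnD 2 2).
  by rewrite -expn4 -[(2 + 2 * k)%N]mulnS -expn4.
rewrite e4 exprD invfM.
have nzAk : A ^+ (4 ^ k) != 0 by rewrite expf_neq0.
have nzAc : A ^+ ((4 ^ k - 1) %/ 3) != 0 by rewrite expf_neq0.
rewrite mulrDr.
have -> : (A ^- (4 ^ k) / A ^+ ((4 ^ k - 1) %/ 3)) * (A ^+ (4 ^ k) * T ^+ (4 ^ k))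
   = T ^+ (4 ^ k) / A ^+ ((4 ^ k - 1) %/ 3) by field; rewrite nzAc nzAk.
ring: two0.
Qed.

(** * The sequence S and the polynomial T^4 + B T^2 + A T *)

Section Continuant.

Variables (F : finFieldType) (A B : F).
Hypothesis ch2 : 2%N \in [pchar F].

Local Notation s := (Sseq A B).

Lemma SseqSS i : s i.+2 = B ^+ (2 ^ i) * s i.+1 + A ^+ (2 ^ i) * s i.
Proof. by []. Qed.

(** [s] is a continuant in Frobenius twists of [A] and [B], and squaring shifts the twists by one;
    this expands it from the opposite end. *)
Lemma Sseq_reverse i : s i.+2 = B * s i.+1 ^+ 2 + A ^+ 2 * s i ^+ 4.
Proof.
suff: s i.+2 = B * s i.+1 ^+ 2 + A ^+ 2 * s i ^+ 4 /\
      s i.+3 = B * s i.+2 ^+ 2 + A ^+ 2 * s i.+1 ^+ 4 by case.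
elim: i => [|i [IH1 IH2]]; first by split=> /=; ring.
split=> //.
have sq_s j : s j.+2 ^+ 2
    = B ^+ (2 ^ j.+1) * s j.+1 ^+ 2 + A ^+ (2 ^ j.+1) * s j ^+ 2.
  by rewrite SseqSS sqrrD_pchar2 // !exprMn -!exprM -!expnSr.
have four_s j : s j.+2 ^+ 4
    = B ^+ (2 ^ j.+2) * s j.+1 ^+ 4 + A ^+ (2 ^ j.+2) * s j ^+ 4.
  rewrite -[4%N]/(2 * 2)%N !(exprM _ 2 2) sq_s sqrrD_pchar2 // !exprMn.
  by rewrite -!(exprM _ (2 ^ _) 2) -!expnSr.
rewrite (SseqSS i.+2) (sq_s i.+1) four_s [in LHS]IH1 [in LHS]IH2.
ring.
Qed.

(* Remainder and quotient of [T ^ (2 ^ n)] modulo [T ^ 4 + B T ^ 2 + A T] in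
   the ring of 2-polynomials under composition. *)
Lemma expr2n_reduce (T : F) (k : nat) :
  T ^+ (2 ^ k.+1) = s k.+1 * T ^+ 2 + A * s k ^+ 2 * T
    + \sum_(0 <= i < k.+1) s (k - i)%N ^+ (2 ^ i.+1)
        * (T ^+ 4 + B * T ^+ 2 + A * T) ^+ (2 ^ i).
Proof.
have two0 := pchar2_2eq0 _ ch2.
elim: k => [|k IHk]; first by rewrite big_nat1 /=; ring.
(* Squaring the identity for [k] creates a T^4 term. Writing T^4 as P(T) + B T^2 + A T yields the
   new summand of index 0, and [Sseq_reverse] gives the coefficient of T^2. *)
rewrite big_nat_recl // subn0 expn1 expn0 expr1.
rewrite expnSr exprM IHk !sqrrD_pchar2 // sum_sqr_pchar2 //.
have -> : \sum_(0 <= i < k.+1) (s (k - i)%N ^+ (2 ^ i.+1)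
        * (T ^+ 4 + B * T ^+ 2 + A * T) ^+ (2 ^ i)) ^+ 2
  = \sum_(0 <= i < k.+1) s (k.+1 - i.+1)%N ^+ (2 ^ i.+2)
        * (T ^+ 4 + B * T ^+ 2 + A * T) ^+ (2 ^ i.+1).
  apply: eq_bigr => i _; rewrite subSS exprMn -!exprM -!expnSr //.
rewrite (Sseq_reverse k).
ring: two0.
Qed.

Lemma Sseq_telescope (T : F) (n : nat) : A != 0 ->
  \sum_(0 <= i < n) A ^ (1 - (2 ^ i.+1)%:Z) * s i.+1
      * (T ^+ 4 + B * T ^+ 2 + A * T) ^+ (2 ^ i)
  = T + A / A ^+ (2 ^ n) * (s n.+1 * T ^+ (2 ^ n) + s n * T ^+ (2 ^ n.+1)).
Proof.
move=> nzA; have two0 := pchar2_2eq0 _ ch2.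
elim: n => [|n IHn].
  by rewrite big_nil expn0 !expr1 divff //=; ring: two0.
have Apow j : A ^ (1 - (2 ^ j)%:Z) = A / A ^+ (2 ^ j).
  by rewrite expfzDr // exprnN.
have nzA2n : A ^+ (2 ^ n) != 0 by rewrite expf_neq0.
rewrite big_nat_recr // IHn.
have -> : (T ^+ 4 + B * T ^+ 2 + A * T) ^+ (2 ^ n)
    = T ^+ (2 ^ n.+2) + B ^+ (2 ^ n) * T ^+ (2 ^ n.+1) + A ^+ (2 ^ n) * T ^+ (2 ^ n).
  rewrite !exprDn_pchar2 // [(B * _) ^+ _]exprMn [(A * _) ^+ _]exprMn.
  by rewrite -!exprM -(expnD 2 2) -expnS.
rewrite Apow SseqSS [in A ^+ (2 ^ n.+1)]expnSr exprM.
set X := T ^+ (2 ^ n); set Y := T ^+ (2 ^ n.+1); set Z := T ^+ (2 ^ n.+2).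
set a := A ^+ (2 ^ n) in nzA2n *; set b := B ^+ (2 ^ n).
set s1 := s n.+1; set s0 := s n; rewrite /=.
apply/eqP; rewrite -subr_eq0; apply/eqP.
(* Only the T^(2^n) contributions remain, one from each side of the induction step, and they are
   equal. *)
transitivity (2%:R * (A / a * (s1 * X))); last by rewrite two0 mul0r.
by field.
Qed.

(** The first halves of the coefficients sum to the quotient part of [expr2n_reduce], the second
    halves telescope, and the T^2 terms cancel. *)
Lemma Mmap_quartic (T : F) (k : nat) :
  A != 0 -> A ^+ (2 ^ k.+1) = A -> T ^+ (2 ^ k.+1) = T ->
  Mmap k.+1 A B (T ^+ 4 + B * T ^+ 2 + A * T) = (s k.+2 + A * s k ^+ 2) * T.
Proof.
move=> nzA Aq Tq; have two0 := pchar2_2eq0 _ ch2.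
rewrite /Mmap.
under eq_bigr => i _ do rewrite mulrDl subSS subn0.
rewrite big_split /= Sseq_telescope // Aq divff // mul1r.
rewrite [in T ^+ (2 ^ k.+2)]expnSr exprM !Tq.
have := expr2n_reduce T k; rewrite Tq.
move/eqP; rewrite [_ + \sum_(_ <= _ < _) _]addrC -subr_eq => /eqP <-.
rewrite -[if k is _.+1 then _ else _]/(s k.+1) -[B ^+ _ * s k.+1 + _]/(s k.+2).
by rewrite (oppr_pchar2 ch2); ring: two0.
Qed.

(* [s k.+2 + A * s k ^+ 2] is the trace over F_2 of the Frobenius map acting on
   the roots of [T ^ 4 + B T ^ 2 + A T]. *)
Lemma Sseq_trace_idem (k : nat) :
  A ^+ (2 ^ k.+1) = A -> B ^+ (2 ^ k.+1) = B ->
  (s k.+2 + A * s k ^+ 2) ^+ 2 = s k.+2 + A * s k ^+ 2.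
Proof.
move=> Aq Bq; have two0 := pchar2_2eq0 _ ch2.
(* The outermost twists, of exponent 2^(k+1), collapse to [B] and [A], so the squared recurrence
   meets the mirrored one. *)
have sq : s k.+2 ^+ 2 = B * s k.+1 ^+ 2 + A * s k ^+ 2.
  by rewrite SseqSS sqrrD_pchar2 // !exprMn -!exprM -!expnSr Aq Bq.
rewrite sqrrD_pchar2 // sq (Sseq_reverse k).
ring: two0.
Qed.

End Continuant.

(** * Inverting the quartic on F_q *)

Lemma Mmap_inverse (K L : finFieldType) (iota : {rmorphism K -> L})
  (m : nat) (A B : L) :
  (0 < m)%N -> 2%N \in [pchar L] -> #|K| = (2 ^ m)%N ->
  A != 0 -> A ^+ (2 ^ m) = A -> B ^+ (2 ^ m) = B ->
  (forall y, y ^+ (2 ^ m) = y -> exists2 T, T ^+ (2 ^ m) = T &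
     y = T ^+ 4 + B * T ^+ 2 + A * T) ->
  forall T, T ^+ (2 ^ m) = T -> Mmap m A B (T ^+ 4 + B * T ^+ 2 + A * T) = T.
Proof.
case: m => // k _ ch2 cardK nzA Aq Bq surj T Tq.
rewrite Mmap_quartic //.
set s := Sseq A B; set Z := s k.+2 + A * s k ^+ 2.
have /eqP : Z * (Z - 1) = 0.
  by rewrite mulrBr mulr1 -expr2 /Z Sseq_trace_idem // subrr.
rewrite mulf_eq0 subr_eq0 => /orP[/eqP Z0 | /eqP ->]; last by rewrite mul1r.
(* By surjectivity, vanishing at all values of the quartic means vanishing on all of F_q. *)
have coef0 (c : nat -> L) :
    (forall T, T ^+ (2 ^ k.+1) = T -> \sum_(0 <= i < k.+1)
       c i * (T ^+ 4 + B * T ^+ 2 + A * T) ^+ (2 ^ i) = 0) ->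
    forall i, (i < k.+1)%N -> c i = 0.
  move=> c0; apply: (additive_poly_coef0 _ _ iota 2) => //; first by rewrite cardK.
  by rewrite cardK => x /surj[U /c0 {}c0 ->].
have /coef0 M0 : forall T, T ^+ (2 ^ k.+1) = T ->
    Mmap k.+1 A B (T ^+ 4 + B * T ^+ 2 + A * T) = 0.
  by move=> U Uq; rewrite Mmap_quartic // -/s -/Z Z0 mul0r.
(* In the top coefficient of [Mmap] the first summand is a power of [s 0], which is 0. *)
have sk0 : s k.+1 = 0.
  have := M0 k (ltnSn k); rewrite subSS subn0 subnn expr0n expn_eq0 /= add0r.
  by move=> /eqP; rewrite mulf_eq0 expfz_eq0 (negbTE nzA) andbF => /eqP.
(* The coefficient of index 0 is [s k ^+ 2] plus 1/A. *)
have Ask : A * s k ^+ 2 = 1.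
  have := M0 0%N (ltn0Sn k); rewrite subSS !subn0 expn1 mulr1.
  rewrite (_ : 1 - 2%:Z = -1) // exprN1 => /eqP.
  by rewrite addr_eq0 (oppr_pchar2 ch2) => /eqP ->; rewrite divff.
have /coef0 R0 : forall T, T ^+ (2 ^ k.+1) = T -> \sum_(0 <= i < k.+1)
    s (k - i)%N ^+ (2 ^ i.+1) * (T ^+ 4 + B * T ^+ 2 + A * T) ^+ (2 ^ i) = 0.
  move=> U Uq; have := expr2n_reduce L A B ch2 U k.
  rewrite -/s sk0 Ask Uq mul0r mul1r add0r => /eqP.
  by rewrite -subr_eq0 opprD addNKr oppr_eq0 => /eqP.
(* The top index carries a power of [s 0], which is 0, so the leading coefficient, a power of [s 1],
   sits one index lower. For [k = 0] there is no such index, and [sk0] itself says 1 = 0. *)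
exfalso; case: k {coef0 M0 surj cardK Aq Bq Tq Ask Z Z0} sk0 R0 => [|k] sk0 R0.
  by have := oner_neq0 L; rewrite -sk0 eqxx.
have := R0 k (leqnSn k.+1); rewrite subSnn expr1n => /eqP.
by rewrite oner_eq0.
Qed.

Lemma Lmap_inverse (K L : finFieldType) (iota : {rmorphism K -> L})
  (m : nat) (A : L) :
  (0 < m)%N -> 2%N \in [pchar L] -> #|K| = (2 ^ m)%N ->
  A != 0 -> A ^+ (2 ^ m) = A -> ~ (exists c : K, A = iota c ^+ 3) ->
  (forall y, y ^+ (2 ^ m) = y -> exists2 T, T ^+ (2 ^ m) = T &
     y = T ^+ 4 + A * T) ->
  forall T, T ^+ (2 ^ m) = T -> Lmap m A (T ^+ 4 + A * T) = T.
Proof.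
move=> m_gt0 ch2 cardK nzA Aq ncube surj T Tq.
have q_gt0 : (0 < 2 ^ m)%N by rewrite expn_gt0.
have Aq1 : A ^+ (2 ^ m - 1) = 1.
  by apply: (mulfI nzA); rewrite -exprS -subSn // subn1 Aq mulr1.
have [m_odd | m_even] := boolP (odd m).
  (* With q = 2^m and [m] odd, 2q is a power of 4, so 3 divides 2q - 1; since A^(2q-1) = A, a cube
     root is A^((2q-1)/3). *)
  case: ncube.
  have dvd3 : (3 %| 2 * 2 ^ m - 1)%N.
    rewrite -expnS -(odd_double_half m.+1) /= m_odd add0n -mul2n -expn4.
    by rewrite -eqn_mod_dvd ?expn_gt0 // -modnXm exp1n.
  have [c ec] : exists c, A ^+ ((2 * 2 ^ m - 1) %/ 3) = iota c.
    by apply: fixed_imageP; rewrite cardK exprAC Aq.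
  exists c; rewrite -ec -exprM divnK //.
  have -> : (2 * 2 ^ m - 1 = 2 ^ m + (2 ^ m - 1))%N by lia.
  by rewrite exprD Aq1 mulr1.
have m2 : m = (m./2 * 2)%N by rewrite muln2 even_halfK.
have d2 : gcdn m 2 = 2%N by rewrite m2 gcdnC gcdnMl.
set h := m./2 in m2.
have eq4 : (4 ^ h = 2 ^ m)%N by rewrite expn4 mulnC -m2.
have h_gt0 : (0 < h)%N by move: m_gt0; rewrite m2 muln_gt0 => /andP[].
rewrite /Lmap d2 divn2 -/h.
rewrite telescope_pow4 // eq4 Tq.
have -> : norm2 m 2 A = A ^+ ((2 ^ m - 1) %/ 3) by [].
set N := A ^+ _.
have nzN : N != 0 by rewrite expf_neq0.
have nzN1 : 1 + N != 0.
  apply/eqP => N1.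
  have {}N1 : N = 1 by apply/eqP; rewrite eq_sym -subr_eq0 (oppr_pchar2 ch2) N1.
  have c0 := additive_poly_coef0 _ _ iota 4 h
    (fun i => A ^- ((4 ^ i.+1 - 1) %/ 3)) isT.
  (* The coefficient of index 0 is 1/A, which cannot vanish. *)
  have /eqP : A ^- ((4 ^ 1 - 1) %/ 3) = 0.
    apply: c0 h_gt0 => [|x]; rewrite cardK ?eq4 // => /surj[U Uq ->].
    by rewrite telescope_pow4 // eq4 Uq -/N N1 invr1 mul1r addrr_pchar2.
  by rewrite invr_eq0 expf_eq0 (negbTE nzA) andbF.
by field; rewrite nzN nzN1.
Qed.

(** * The trace of f and the reduction to the quartic *)

Section Trace.

Variables (F : finFieldType) (m : nat).
Hypotheses (ch2 : 2%N \in [pchar F])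
  (xq3 : forall x : F, x ^+ ((2 ^ m) ^ 3) = x).
Local Notation q := (2 ^ m)%N.
Local Notation Tr := (tr3 q).

Lemma tr3D (x y : F) : Tr (x + y) = Tr x + Tr y.
Proof. by rewrite /tr3 -expnM !exprDn_pchar2 //; ring. Qed.

Lemma tr3_fixed (x : F) : Tr x ^+ q = Tr x.
Proof.
rewrite /tr3 !exprDn_pchar2 // -!exprM -expnSr xq3.
by rewrite -[(q * q)%N]/(q ^ 2)%N; ring.
Qed.

Lemma tr3_expr2n (l : nat) (x : F) : Tr (x ^+ (2 ^ l)) = Tr x ^+ (2 ^ l).
Proof. by rewrite /tr3 !exprDn_pchar2 // !(exprAC _ (2 ^ l)%N). Qed.

Lemma tr3Ml (a x : F) : a ^+ q = a -> Tr (a * x) = a * Tr x.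
Proof.
move=> aq; rewrite /tr3 !exprMn [a ^+ (q ^ 2)]exprM !aq; ring.
Qed.

Lemma tr3_id (a : F) : a ^+ q = a -> Tr a = a.
Proof.
by move=> aq; rewrite /tr3 [a ^+ (q ^ 2)]exprM !aq addrr_pchar2 ?add0r.
Qed.

(** The last two terms of f have equal traces, which cancel. The first is T + delta times its norm;
    the norm lies in F_q and leaves the trace. *)
Lemma tr3_fpoly (l : nat) (delta x : F) :
  Tr (fpoly q l delta x) + cD q delta
  = Tr x ^+ 4 + cB q delta * Tr x ^+ 2 + cA q delta * Tr x.
Proof.
have two0 := pchar2_2eq0 _ ch2.
have Tq := tr3_fixed x.
set T := Tr x in Tq *.
have -> : Tr (fpoly q l delta x) = Tr ((T + delta) ^+ (q ^ 2 + q + 2)).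
  rewrite /fpoly -/T 2!tr3D !tr3_expr2n (tr3_id T Tq) -/T.
  by rewrite -addrA addrr_pchar2 // addr0.
clearbody T; set b := delta ^+ q; pose c := b ^+ q.
have ec : delta ^+ (q ^ 2) = c by rewrite /c /b -exprM.
have cq : c ^+ q = delta by rewrite /c /b -!exprM; exact: xq3.
have trE y : Tr y = y + y ^+ q + y ^+ q ^+ q by rewrite /tr3 -exprM.
have -> : (T + delta) ^+ (q ^ 2 + q + 2)
    = (T + delta) * (T + b) * (T + c) * (T + delta).
  rewrite !exprD [(q ^ 2)%N]/(q * q)%N exprM !exprDn_pchar2 // !Tq -/b -/c; ring.
rewrite tr3Ml; last by rewrite !exprMn !exprDn_pchar2 // Tq cq -/b -/c; ring.
rewrite tr3D (tr3_id T Tq) /cD /cB /cA !tr3D !exprD expr1 ec -/b !trE.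
have exprMq (y z : F) : (y * z) ^+ q = y ^+ q * z ^+ q by rewrite exprMn.
have sqrq (y : F) : y ^+ 2 ^+ q = y ^+ q ^+ 2 by rewrite exprAC.
rewrite !(exprMq, sqrq) -/b -/c !cq -/b.
apply/eqP; rewrite -subr_eq0; apply/eqP.
(* Before 2 = 0 is used, the two sides differ by exactly this multiple of 2. *)
transitivity (2%:R * (T ^+ 3 * (delta + b + c)
  + T ^+ 2 * (delta * b + b * c + c * delta)
  + delta * b * c * (2%:R * T + delta + b + c))).
  by ring.
by rewrite two0 mul0r.
Qed.

(* The trace of [x] determines [x] from [f x], since all other terms of [f x]
   depend on the trace only. *)
Lemma fpoly_inverse (l : nat) (delta : F) (g : F -> F) :
  bijective (fpoly q l delta) ->
  (forall T, T ^+ q = T ->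
     g (T ^+ 4 + cB q delta * T ^+ 2 + cA q delta * T) = T) ->
  comp_inverse (fpoly q l delta) (fun x =>
    let e := (3 * m)%:Z - l%:Z in let G := g (Tr x + cD q delta) in
    frob2 ((delta + G) ^+ (q ^ 2 + q + 2)) e + frob2 x e + G).
Proof.
move=> bij_f gK.
have fK : cancel (fpoly q l delta) (fun x =>
    let e := (3 * m)%:Z - l%:Z in let G := g (Tr x + cD q delta) in
    frob2 ((delta + G) ^+ (q ^ 2 + q + 2)) e + frob2 x e + G).
  (* Comparing 2^l-th powers replaces each [frob2] by its argument. *)
  move=> x /=; apply: (expr2n_inj _ l ch2) => /=.
  have xn z : z ^+ (2 ^ (3 * m)) = z :> F by rewrite mulnC expnM xq3.
  rewrite !exprDn_pchar2 // !frob2BK // tr3_fpoly gK ?tr3_fixed //.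
  have two0 := pchar2_2eq0 _ ch2.
  by rewrite /fpoly [delta + _]addrC; ring: two0.
split=> //; exact/(bij_can_sym bij_f).
Qed.

(** [y] and [cD q delta] lie in F_q, where the trace is the identity; so the trace of a preimage of
    their sum is sent to [y]. *)
Lemma fpoly_quartic_surj (l : nat) (delta : F) :
  bijective (fpoly q l delta) ->
  forall y, y ^+ q = y -> exists2 T, T ^+ q = T &
    y = T ^+ 4 + cB q delta * T ^+ 2 + cA q delta * T.
Proof.
case=> f' _ f'K y yq.
have Dq : cD q delta ^+ q = cD q delta.
  rewrite /cD exprMn tr3_fixed; congr (_ * _).
  by rewrite !exprD !expr1 !exprMn -!exprM -expnSr xq3 -[(q * q)%N]/(q ^ 2)%N; ring.
exists (Tr (f' (y + cD q delta))); first exact: tr3_fixed.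
rewrite -(tr3_fpoly l) f'K tr3D !tr3_id //.
by rewrite -addrA addrr_pchar2 // addr0.
Qed.

End Trace.

Theorem theorem3
  (m l : nat) (q : nat) (Fq Fq3 : finFieldType) (iota : {rmorphism Fq -> Fq3})
  (delta : Fq3)
  (m_gt0 : (0 < m)%N) (q_def : q = (2 ^ m)%N)
  (card_Fq : #|Fq| = q) (card_Fq3 : #|Fq3| = (q ^ 3)%N)
  (f_perm : bijective (fpoly q l delta)) :
  let A := cA q delta in
  let B := cB q delta in
  let D := cD q delta in
  let e := (3 * m)%:Z - l%:Z in
  [/\ A = 0 -> B = 0 ->
        comp_inverse (fpoly q l delta) (fun x =>
          frob2 x e
          + frob2 ((frob2 (tr3 q x + D) (m%:Z - 2) + delta)
                     ^+ (q ^ 2 + q + 2)) e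
          + frob2 (tr3 q x + D) (m%:Z - 2)),
      B = 0 -> A <> 0 -> ~ (exists c : Fq, A = iota c ^+ 3) ->
        comp_inverse (fpoly q l delta) (fun x =>
          frob2 ((delta + Lmap m A (tr3 q x + D)) ^+ (q ^ 2 + q + 2)) e
          + frob2 x e
          + Lmap m A (tr3 q x + D))
    & A * B <> 0 ->
        comp_inverse (fpoly q l delta) (fun x =>
          frob2 ((delta + Mmap m A B (tr3 q x + D)) ^+ (q ^ 2 + q + 2)) e
          + frob2 x e
          + Mmap m A B (tr3 q x + D))].
Proof.
subst q => A B D e.
have ch2 : 2%N \in [pchar Fq3].
  by apply: (@card_finPcharP _ _ (m * 3)) => //; rewrite card_Fq3 expnM.
have xq3 (x : Fq3) : x ^+ ((2 ^ m) ^ 3) = x by rewrite -card_Fq3 expf_card.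
have surj := fpoly_quartic_surj _ _ ch2 xq3 _ _ f_perm.
have Aq : A ^+ (2 ^ m) = A by apply: tr3_fixed.
have Bq : B ^+ (2 ^ m) = B by apply: tr3_fixed.
have inv g := fpoly_inverse _ _ ch2 xq3 _ _ g f_perm.
rewrite -/A -/B in surj inv.
split.
- move=> A0 B0.
  have [T Tq|can1 can2] := inv (fun y => frob2 y (m%:Z - 2)).
    (* Fourth powers are compared; for [m = 1] the exponent [m - 2] is negative. *)
    rewrite A0 B0 !mul0r !addr0; apply: (expr2n_inj _ 2 ch2) => /=.
    by rewrite frob2BK // exprAC Tq.
  split=> x; [rewrite -[RHS]can1 | rewrite -[RHS]can2] => /=.
    by rewrite [delta + _]addrC [X in _ = X + _]addrC.
  by congr fpoly; rewrite [delta + _]addrC [X in _ = X + _]addrC.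
- move=> B0 A0 ncube; apply: (inv (Lmap m A)) => T Tq.
  rewrite B0 mul0r addr0; apply: (Lmap_inverse _ _ iota) => //; first exact/eqP.
  by move=> y /surj[U Uq ->]; exists U => //; rewrite B0 mul0r addr0.
- move=> /eqP; rewrite mulf_eq0 negb_or => /andP[A0 _].
  by apply: (inv (Mmap m A B)) => T Tq; apply: (Mmap_inverse _ _ iota).
Qed.
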